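(* Let $0<q<1$ be fixed and let $R>0$ be any fixed positive number. (i) Let $t$ be a fixed real number with $-\infty<t<2$, and put $\sigma=\max\{\tfrac12,\tfrac12+\tfrac t4\}$. Then there exists $n_0$ (depending on $q,R,t$) such that for all integers $n\ge n_0$ and all $u\in\mathbb C$ with $|u|\le R$, setting $z:=uq^{-nt}$, we have $$S_n(z;q)=\frac{1}{(q;q)_n}\left[A_q(z)+r_n(z)\right],$$ where the remainder $r_n(z)$ (defined by this equation) satisfies $$|r_n(z)|\le\left[\frac{q^{n(1-\sigma)}}{1-q}+\frac{2}{1-q}\left(\frac12\right)^{\lfloor n\sigma\rfloor}\right]A_q(-|z|).$$ (ii) Let $t$ be a fixed real number with $0<t<\infty$, and put $\delta=\min\{\tfrac32,1+\tfrac t4\}$. Then there exists $n_0$ (depending on $q,R,t$) such that for all integers $n\ge n_0$ and all $u\in\mathbb C$ with $|u|\ge 1/R$, setting $z:=uq^{-nt}$, we have $$S_n(z;q)=\frac{(-z)^nq^{n^2}}{(q;q)_n}\left[A_q\left(q^{-2n}/z\right)+r_n(z)\right],$$ where the remainder $r_n(z)$ (defined by this equation) satisfies $$|r_n(z)|\le\left[\frac{q^{n(\delta-1)}}{1-q}+\frac{2}{1-q}\left(\frac12\right)^{\lfloor n(2-\delta)\rfloor}\right]A_q\left(-q^{-2n}/|z|\right).$$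
   Context: For $0<q<1$, the $q$-shifted factorial is $(a;q)_0=1$, $(a;q)_n=\prod_{j=0}^{n-1}(1-aq^j)$ for $n\ge1$. The Stieltjes-Wigert polynomials are $$S_n(z;q)=\sum_{j=0}^n\frac{q^{j^2}}{(q;q)_j(q;q)_{n-j}}(-z)^j,\qquad n=0,1,2,\dots,$$ and the $q$-Airy function is the entire function $$A_q(z)=\sum_{k=0}^\infty\frac{q^{k^2}}{(q;q)_k}(-z)^k .$$ $\lfloor\cdot\rfloor$ denotes the floor function. In both parts, $z$ denotes the complex number $uq^{-nt}$, where $q^{-nt}$ is a positive real power. *)

(* Defs.v *)
From Stdlib Require Import Reals Lra Lia ZArith.
From Coquelicot Require Import Coquelicot.
Open Scope R_scope.

(* (a;q)_n = \prod_{j=0}^{n-1} (1 - a q^j) *)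
Fixpoint qpoch (a q : R) (n : nat) : R :=
  match n with
  | O => 1
  | S m => qpoch a q m * (1 - a * q ^ m)
  end.

(* Coquelicot's [sum_n a n] has the n+1 terms a 0, ..., a n. *)
Definition SW (q : R) (n : nat) (z : C) : C :=
  sum_n (fun j : nat =>
    (RtoC (q ^ (j * j)%nat / (qpoch q q j * qpoch q q (n - j)%nat))
       * (- z) ^ j)%C) n.

Definition Aq_term (q : R) (z : C) (k : nat) : C :=
  (RtoC (q ^ (k * k)%nat / qpoch q q k) * (- z) ^ k)%C.

(* The sum of the complex series [Aq_term q z].  Coquelicot's [Series] is
   restricted to real series; [iota] selects the limit, and [Aq_is_series]
   below shows that the series does converge, to this value. *)
Definition Aq (q : R) (z : C) : C :=
  iota (fun l : C_R_CompleteNormedModule => is_series (Aq_term q z) l).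

Lemma qpoch_pos (q : R) (n : nat) : 0 < q < 1 -> 0 < qpoch q q n.
Proof.
  intros Hq; induction n as [|n IH]; simpl; [lra|].
  apply Rmult_lt_0_compat; [exact IH|].
  assert (H : q ^ n <= 1) by (rewrite <- (pow1 n); apply pow_incr; lra).
  assert (H0 : 0 < q ^ n) by (apply pow_lt; lra).
  nra.
Qed.

Lemma Aq_majorant_cv (q x : R) : 0 < q < 1 -> 0 < x ->
  ex_series (fun k : nat => q ^ (k * k)%nat / qpoch q q k * x ^ k).
Proof.
  intros Hq Hx.
  assert (Hpos : forall k, 0 < q ^ (k * k)%nat / qpoch q q k * x ^ k).
  { intros k; apply Rmult_lt_0_compat; [|now apply pow_lt].
    apply Rdiv_lt_0_compat; [apply pow_lt; lra|now apply qpoch_pos]. }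
  apply ex_series_ext with
    (fun k : nat => Rabs (q ^ (k * k)%nat / qpoch q q k * x ^ k)).
  { intros k; apply Rabs_pos_eq, Rlt_le, Hpos. }
  apply ex_series_DAlembert with 0; [lra| |].
  { intros k; apply Rgt_not_eq, Hpos. }
  apply is_lim_seq_ext with
    (fun k : nat => q ^ k * (q ^ k * (q * x / (1 - q * q ^ k)))).
  { intros k. rewrite Rabs_pos_eq; [|apply Rlt_le, Rdiv_lt_0_compat; apply Hpos].
    replace (S k * S k)%nat with (k * k + (k + (k + 1)))%nat by lia.
    rewrite !pow_add. simpl.
    assert (Hk := qpoch_pos q k Hq). assert (Hk1 := qpoch_pos q (S k) Hq).
    simpl in Hk1.
    assert (0 < q ^ (k * k)) by (apply pow_lt; lra).
    assert (0 < x ^ k) by (apply pow_lt; lra).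
    field. repeat split; try lra. nra. }
  assert (Hg : is_lim_seq (fun k => q ^ k) 0).
  { apply is_lim_seq_geom. rewrite Rabs_pos_eq; lra. }
  replace (Finite 0) with (Finite (0 * (0 * (q * x / (1 - q * 0)))))
    by (f_equal; ring).
  apply is_lim_seq_mult'; [exact Hg|].
  apply is_lim_seq_mult'; [exact Hg|].
  apply is_lim_seq_div'; [apply is_lim_seq_const| |lra].
  apply is_lim_seq_minus'; [apply is_lim_seq_const|].
  apply is_lim_seq_mult'; [apply is_lim_seq_const|exact Hg].
Qed.

Lemma Aq_is_series (q : R) (z : C) : 0 < q < 1 ->
  @is_series R_AbsRing C_R_NormedModule (Aq_term q z) (Aq q z).
Proof.
  intros Hq.
  assert (Hex : @ex_series R_AbsRing C_R_CompleteNormedModule (Aq_term q z)).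
  { apply (@ex_series_le R_AbsRing C_R_CompleteNormedModule) with
      (fun k : nat => q ^ (k * k)%nat / qpoch q q k * (Cmod z + 1) ^ k).
    2:{ apply Aq_majorant_cv; [exact Hq|]. generalize (Cmod_ge_0 z); lra. }
    intros k.
    change (norm (Aq_term q z k)) with (@norm R_AbsRing C_R_NormedModule (Aq_term q z k)).
    rewrite <- Cmod_norm. unfold Aq_term.
    rewrite Cmod_mult, Cmod_R, Cmod_pow, Cmod_opp.
    assert (0 < q ^ (k * k)%nat / qpoch q q k).
    { apply Rdiv_lt_0_compat; [apply pow_lt; lra|now apply qpoch_pos]. }
    rewrite Rabs_pos_eq by lra.
    apply Rmult_le_compat_l; [lra|].
    apply pow_incr. generalize (Cmod_ge_0 z); lra. }
  destruct Hex as [l Hl].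
  unfold Aq.
  rewrite (iota_unique (V := C_R_CompleteNormedModule) _ l); [exact Hl| |exact Hl].
  intros y Hy.
  exact (filterlim_locally_unique (V := C_R_NormedModule) _ y l Hy Hl).
Qed.

Lemma Im_sum_n (a : nat -> C) (n : nat) :
  Im (sum_n a n) = sum_n (fun k => Im (a k)) n.
Proof.
  induction n as [|n IH]; [now rewrite !sum_O|].
  rewrite !sum_Sn, <- IH; reflexivity.
Qed.

(* A_q is real on the real axis, so that [Re (Aq q (RtoC x))] is its real
   value there. *)
Lemma Aq_real (q x : R) : 0 < q < 1 ->
  Aq q (RtoC x) = RtoC (Re (Aq q (RtoC x))).
Proof.
  intros Hq.
  assert (H := Aq_is_series q (RtoC x) Hq).
  assert (HIm : is_lim_seq (fun n : nat => 0) (Im (Aq q (RtoC x)))).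
  { apply is_lim_seq_ext with (fun n => Im (sum_n (Aq_term q (RtoC x)) n)).
    - intros n. rewrite Im_sum_n, (sum_n_ext _ (fun _ => 0)).
      + rewrite sum_n_const; ring.
      + intros k; unfold Aq_term.
        rewrite <- RtoC_opp, <- RtoC_pow, <- RtoC_mult; reflexivity.
    - apply filterlim_comp with (1 := H).
      intros P [e He]; exists e; intros y Hy; apply He, Hy. }
  apply is_lim_seq_unique in HIm. rewrite Lim_seq_const in HIm.
  injection HIm as HIm.
  apply injective_projections; [reflexivity|]. symmetry; exact HIm.
Qed.

(* Main.v *)
(** Both expansions compare the same truncated series
    [sum_(j <= n) (q;q)_n / (q;q)_(n-j) * (j-th term of A_q(w))] with [A_q(w)]: in (i)
    [w = z], and in (ii), after reversing the sum, [w = q^(-2n) / z], which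
    satisfies the bound of (i) with [2 - t] in place of [t].  Up to
    [j = floor(n sigma)] the factor [(q;q)_n / (q;q)_(n-j)] differs from 1 by at
    most [q^(n-j) / (1-q)].  The terms of [A_q(-|w|)] peak near [j = max(0, n t / 2)];
    from [n tau] on, with [max(0, t/2) < tau < sigma], the ratio of consecutive terms is
    exponentially small in [n], so the terms beyond [n sigma] are at most
    [2^(-j)] times the sum. *)

Require Import Defs.
From Stdlib Require Import Reals ZArith Lra Lia.
From Coquelicot Require Import Coquelicot.
Open Scope R_scope.

(* [ring] does not see through the canonical-structure carriers that
   Coquelicot's [sum_n] lemmas leave as the type of the equation. *)
Ltac C_ring := match goal with |- @eq _ ?a ?b => change (@eq C a b) end; ring.

(** * Monotonicity of powers; reversal of a finite sum *)

Lemma pow_le_antimono (q : R) (m n : nat) :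
  0 < q < 1 -> (m <= n)%nat -> q ^ n <= q ^ m.
Proof.
  intros Hq Hmn.
  replace n with (m + (n - m))%nat by lia. rewrite pow_add.
  assert (0 < q ^ m) by (apply pow_lt; lra).
  assert (q ^ (n - m) <= 1) by (rewrite <- (pow1 (n - m)); apply pow_incr; lra).
  nra.
Qed.

Lemma Rpower_le_antimono (q x y : R) :
  0 < q < 1 -> x <= y -> Rpower q y <= Rpower q x.
Proof.
  intros Hq [Hxy| ->]; [|lra]. left. apply exp_increasing.
  assert (ln q < 0) by (rewrite <- ln_1; apply ln_increasing; lra).
  nra.
Qed.

Lemma Rpower_lt_1 (q x : R) : 0 < q < 1 -> 0 < x -> Rpower q x < 1.
Proof.
  intros Hq Hx. unfold Rpower. rewrite <- exp_0. apply exp_increasing.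
  assert (ln q < 0) by (rewrite <- ln_1; apply ln_increasing; lra).
  nra.
Qed.

Lemma Rpower_gt_0 (q x : R) : 0 < Rpower q x.
Proof. apply exp_pos. Qed.

Lemma sum_n_rev {G : AbelianMonoid} (a : nat -> G) (n : nat) :
  sum_n (fun j => a (n - j)%nat) n = sum_n a n.
Proof.
  induction n as [|n IH]; [now rewrite !sum_O|].
  rewrite (sum_Sn a), <- IH. unfold sum_n at 1.
  rewrite sum_Sn_m by lia. rewrite <- sum_n_m_S.
  rewrite plus_comm. f_equal.
Qed.

(** * Quotients of q-shifted factorials *)

(** This is the inequality [prod (1 - x_i) >= 1 - sum x_i] for [x_i = q^(m+i)], [1 <= i <= j]. The
    geometric sum stays in closed form, with its factor [1 - q ^ j], so that the induction on [j]
    closes. *)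
Lemma qpoch_add_bounds (q : R) (m j : nat) : 0 < q < 1 ->
  qpoch q q m * (1 - q ^ S m * (1 - q ^ j) / (1 - q)) <= qpoch q q (m + j)
  <= qpoch q q m.
Proof.
  intros Hq. assert (Hm := qpoch_pos q m Hq).
  induction j as [|j IH].
  - rewrite Nat.add_0_r. simpl. split; [|lra].
    right. field. lra.
  - rewrite Nat.add_succ_r.
    change (qpoch q q (S (m + j))) with (qpoch q q (m + j) * (1 - q * q ^ (m + j))).
    assert (Hj : 0 < q ^ (m + j)) by (apply pow_lt; lra).
    assert (Hj1 : q ^ (m + j) <= 1) by (rewrite <- (pow1 (m + j)); apply pow_incr; lra).
    assert (Hmj := qpoch_pos q (m + j) Hq).
    split.
    2:{ assert (0 <= q * q ^ (m + j)) by nra.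
        assert (0 <= qpoch q q (m + j) * (q * q ^ (m + j))) by (apply Rmult_le_pos; lra).
        lra. }
    set (s := q ^ S m * (1 - q ^ j) / (1 - q)) in *.
    assert (Hs : 0 <= s).
    { unfold s. apply Rmult_le_pos; [|left; apply Rinv_0_lt_compat; lra].
      apply Rmult_le_pos; [left; apply pow_lt; lra|].
      assert (q ^ j <= 1) by (rewrite <- (pow1 j); apply pow_incr; lra). lra. }
    replace (q ^ S m * (1 - q ^ S j) / (1 - q)) with (s + q * q ^ (m + j)).
    2:{ unfold s. rewrite pow_add. simpl. field. lra. }
    set (x := q * q ^ (m + j)) in *.
    assert (0 < x < 1) by (unfold x; nra).
    apply Rle_trans with (qpoch q q m * (1 - s) * (1 - x)).
    + assert (0 <= qpoch q q m * (s * x)) by (apply Rmult_le_pos; [lra|nra]). nra.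
    + apply Rmult_le_compat_r; lra.
Qed.

Lemma qpoch_quot_bounds (q : R) (n j : nat) : 0 < q < 1 -> (j <= n)%nat ->
  1 - q ^ (n - j) / (1 - q) <= qpoch q q n / qpoch q q (n - j) <= 1.
Proof.
  intros Hq Hj.
  assert (Hm := qpoch_pos q (n - j) Hq).
  destruct (qpoch_add_bounds q (n - j) j Hq) as [H1 H2].
  replace (n - j + j)%nat with n in H1, H2 by lia.
  assert (Hp : 0 < q ^ (n - j)) by (apply pow_lt; lra).
  assert (Hj1 : 0 < q ^ j) by (apply pow_lt; lra).
  split.
  - apply Rmult_le_reg_l with (qpoch q q (n - j)); [lra|].
    replace (qpoch q q (n - j) * (qpoch q q n / qpoch q q (n - j)))
      with (qpoch q q n) by (field; lra).
    eapply Rle_trans; [|exact H1].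
    apply Rmult_le_compat_l; [lra|].
    apply Rplus_le_compat_l, Ropp_le_contravar.
    apply Rmult_le_compat_r; [left; apply Rinv_0_lt_compat; lra|].
    simpl. assert (q * (1 - q ^ j) <= 1) by nra. nra.
  - apply Rmult_le_reg_r with (qpoch q q (n - j)); [lra|].
    replace (qpoch q q n / qpoch q q (n - j) * qpoch q q (n - j))
      with (qpoch q q n) by (field; lra). lra.
Qed.

(** * The majorant series [A_q(-|z|)] *)

Definition Aq_abs_term (q x : R) (k : nat) : R :=
  q ^ (k * k)%nat / qpoch q q k * x ^ k.

Lemma Aq_abs_term_ge_0 (q x : R) (k : nat) : 0 < q < 1 -> 0 <= x ->
  0 <= Aq_abs_term q x k.
Proof.
  intros Hq Hx. apply Rmult_le_pos; [|now apply pow_le].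
  left. apply Rdiv_lt_0_compat; [apply pow_lt; lra|now apply qpoch_pos].
Qed.

Lemma Cmod_Aq_term (q : R) (z : C) (k : nat) : 0 < q < 1 ->
  Cmod (Aq_term q z k) = Aq_abs_term q (Cmod z) k.
Proof.
  intros Hq. unfold Aq_term, Aq_abs_term.
  rewrite Cmod_mult, Cmod_R, Cmod_pow, Cmod_opp.
  rewrite Rabs_pos_eq; [reflexivity|].
  left. apply Rdiv_lt_0_compat; [apply pow_lt; lra|now apply qpoch_pos].
Qed.

Lemma Re_sum_n (a : nat -> C) (n : nat) :
  Re (sum_n a n) = sum_n (fun k => Re (a k)) n.
Proof.
  induction n as [|n IH]; [now rewrite !sum_O|].
  rewrite !sum_Sn, <- IH; reflexivity.
Qed.

(** At [-x] the sign inside [Aq_term] cancels, so its terms there are the real numbers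
    [Aq_abs_term q x k], and [Re] is continuous. *)
Lemma is_lim_seq_Aq_abs (q x : R) : 0 < q < 1 ->
  is_lim_seq (sum_n (Aq_abs_term q x)) (Re (Aq q (RtoC (- x)))).
Proof.
  intros Hq. assert (H := Aq_is_series q (RtoC (- x)) Hq).
  apply is_lim_seq_ext with (fun n => Re (sum_n (Aq_term q (RtoC (- x))) n)).
  - intros n. rewrite Re_sum_n. apply sum_n_ext. intros k.
    unfold Aq_term, Aq_abs_term.
    rewrite <- RtoC_opp, <- RtoC_pow, <- RtoC_mult, Ropp_involutive. reflexivity.
  - apply filterlim_comp with (1 := H).
    intros P [e He]; exists e; intros y Hy; apply He, Hy.
Qed.

Lemma sum_Aq_abs_le (q x : R) (n : nat) : 0 < q < 1 -> 0 <= x ->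
  sum_n (Aq_abs_term q x) n <= Re (Aq q (RtoC (- x))).
Proof.
  intros Hq Hx. apply is_lim_seq_incr_compare; [now apply is_lim_seq_Aq_abs|].
  intros k. rewrite sum_Sn. unfold plus; simpl.
  generalize (Aq_abs_term_ge_0 q x (S k) Hq Hx); lra.
Qed.

Lemma Aq_abs_term_le (q x : R) (k : nat) : 0 < q < 1 -> 0 <= x ->
  Aq_abs_term q x k <= Re (Aq q (RtoC (- x))).
Proof.
  intros Hq Hx. eapply Rle_trans; [|exact (sum_Aq_abs_le q x k Hq Hx)].
  destruct k as [|k]; [rewrite sum_O; lra|].
  rewrite sum_Sn. unfold plus; simpl.
  assert (0 <= sum_n (Aq_abs_term q x) k); [|lra].
  replace 0 with (sum_n (fun _ : nat => 0) k) by (rewrite sum_n_const; apply Rmult_0_r).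
  apply sum_n_m_le. intros i. now apply Aq_abs_term_ge_0.
Qed.

(** * [S_n] as a weighted truncation of the [A_q] series *)

(** This is [(q;q)_n S_n(z;q)], arranged so that each term of [A_q(z)] carries a weight in
    [(0,1]]. *)
Definition Aq_trunc (q : R) (n : nat) (z : C) : C :=
  sum_n (fun j => (RtoC (qpoch q q n / qpoch q q (n - j)) * Aq_term q z j)%C) n.

Lemma SW_trunc (q : R) (n : nat) (z : C) : 0 < q < 1 ->
  SW q n z = (RtoC (1 / qpoch q q n) * Aq_trunc q n z)%C.
Proof.
  intros Hq. unfold SW, Aq_trunc.
  rewrite <- (sum_n_mult_l (K := C_Ring)).
  apply sum_n_ext. intros j. unfold Aq_term, mult; simpl.
  rewrite !Cmult_assoc, <- !RtoC_mult. f_equal. f_equal.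
  assert (H1 := qpoch_pos q n Hq). assert (H2 := qpoch_pos q j Hq).
  assert (H3 := qpoch_pos q (n - j) Hq). field. lra.
Qed.

(** Under [j -> n - j] the denominator is symmetric, and [(n-j)^2 = n^2 + j^2 - 2nj]. The factors
    [q^(-2nj)] and [(-z)^(-j)] combine into the [j]-th power of [-w], with [w = q^(-2n)/z]. *)
Lemma SW_trunc_rev (q : R) (n : nat) (z : C) : 0 < q < 1 -> z <> RtoC 0 ->
  SW q n z = ((- z) ^ n * RtoC (q ^ (n * n)%nat / qpoch q q n)
              * Aq_trunc q n (RtoC (/ q ^ (2 * n)%nat) / z))%C.
Proof.
  intros Hq Hz. unfold SW, Aq_trunc.
  rewrite <- sum_n_rev, <- (sum_n_mult_l (K := C_Ring)).
  apply sum_n_ext_loc. intros j Hj. unfold Aq_term. change (@mult C_Ring) with Cmult.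
  replace (n - (n - j))%nat with j by lia.
  assert (H1 := qpoch_pos q n Hq). assert (H2 := qpoch_pos q j Hq).
  assert (H3 := qpoch_pos q (n - j) Hq).
  assert (Hpow : ((- (RtoC (/ q ^ (2 * n)) / z)) ^ j
                  = RtoC ((/ q ^ (2 * n)) ^ j) * (/ (- z)) ^ j)%C).
  { rewrite RtoC_pow, <- Cpow_mult_l. f_equal. field. exact Hz. }
  rewrite Hpow.
  assert (Hzz : ((- z) ^ n * (/ (- z)) ^ j = (- z) ^ (n - j))%C).
  { replace n with (n - j + j)%nat at 1 by lia.
    rewrite Cpow_add_r, <- Cmult_assoc, <- Cpow_mult_l, Cinv_r, Cpow_1_l; [ring|].
    intros H0. apply Hz. replace z with (- - z)%C by ring. rewrite H0. ring. }
  rewrite <- Hzz.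
  assert (Hc : q ^ ((n - j) * (n - j)) / (qpoch q q (n - j) * qpoch q q j)
     = q ^ (n * n) / qpoch q q n * (qpoch q q n / qpoch q q (n - j)
       * (q ^ (j * j) / qpoch q q j * (/ q ^ (2 * n)) ^ j))).
  { assert (Hp : q ^ ((n - j) * (n - j)) = q ^ (n * n) * q ^ (j * j) * (/ q ^ (2 * n)) ^ j).
    { rewrite pow_inv, <- pow_mult.
      apply Rmult_eq_reg_r with (q ^ (2 * n * j)); [|apply pow_nonzero; lra].
      rewrite Rmult_assoc, Rinv_l, Rmult_1_r, <- !pow_add; [|apply pow_nonzero; lra].
      (* The exponents agree as naturals: [(n-j)^2 + 2nj = n^2 + j^2], where [j <= n] keeps the
         subtraction from truncating. *)
      f_equal. nia. }
    rewrite Hp. field. lra. }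
  rewrite Hc, !RtoC_mult. C_ring.
Qed.

(** * The truncation error *)

Lemma sum_half_pow_tail (m N : nat) :
  sum_n (fun j => if le_lt_dec j m then 0 else (1 / 2) ^ j) N <= (1 / 2) ^ m.
Proof.
  (* Sharpened to a telescoping form for the induction: [2^(-j) = 2^(-(j-1)) - 2^(-j)]. *)
  assert (H : sum_n (fun j => if le_lt_dec j m then 0 else (1 / 2) ^ j) N
              <= if le_lt_dec N m then 0 else (1 / 2) ^ m - (1 / 2) ^ N).
  { induction N as [|N IH].
    - rewrite sum_O. destruct (le_lt_dec 0 m); [lra|lia].
    - rewrite sum_Sn. change (@plus R_AbelianMonoid) with Rplus.
      destruct (le_lt_dec N m), (le_lt_dec (S N) m); try lia; try lra.
      + replace m with N in * by lia. rewrite <- tech_pow_Rmult. lra.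
      + rewrite <- tech_pow_Rmult. lra. }
  eapply Rle_trans; [exact H|].
  assert (0 < (1 / 2) ^ m) by (apply pow_lt; lra).
  assert (0 < (1 / 2) ^ N) by (apply pow_lt; lra).
  destruct (le_lt_dec N m); lra.
Qed.

Lemma Cmod_sum_n_le (a : nat -> C) (n : nat) :
  Cmod (sum_n a n) <= sum_n (fun k => Cmod (a k)) n.
Proof.
  induction n as [|n IH]; [rewrite !sum_O; lra|].
  rewrite !sum_Sn. unfold plus; simpl.
  eapply Rle_trans; [apply Cmod_triangle|]. lra.
Qed.

(** The difference is a single series with terms [(c j - 1)] times those of [A_q(w)]. Up to [m] the
    weight is within [q^(n-m)/(1-q)] of 1. Beyond [m] only [|c j - 1| <= 1] is used, and the assumed
    decay supplies a geometric tail. *)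
Lemma Aq_trunc_remainder (q : R) (n m : nat) (w : C) :
  0 < q < 1 -> (m <= n)%nat ->
  (forall j, (m < j)%nat ->
     Aq_abs_term q (Cmod w) j <= (1 / 2) ^ j * Re (Aq q (RtoC (- Cmod w)))) ->
  Cmod (Aq_trunc q n w - Aq q w)
  <= (q ^ (n - m) / (1 - q) + (1 / 2) ^ m) * Re (Aq q (RtoC (- Cmod w))).
Proof.
  intros Hq Hmn Htail.
  set (M := Re (Aq q (RtoC (- Cmod w)))) in *.
  set (eps := q ^ (n - m) / (1 - q)).
  (* The cutoff is explicit: for [j > n] the truncated [n - j] is 0, and the quotient would be
     [(q;q)_n] instead of 0. *)
  set (c := fun j => if le_lt_dec j n then qpoch q q n / qpoch q q (n - j) else 0).
  assert (Hw := Cmod_ge_0 w).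
  assert (HM : 0 <= M).
  { eapply Rle_trans; [|apply (Aq_abs_term_le q (Cmod w) 0 Hq Hw)].
    now apply Aq_abs_term_ge_0. }
  assert (Heps : 0 <= eps).
  { left. apply Rdiv_lt_0_compat; [apply pow_lt; lra|lra]. }
  set (d := fun j => ((RtoC (c j) - 1) * Aq_term q w j)%C).
  assert (Hd : forall N, (n <= N)%nat ->
    sum_n d N = (Aq_trunc q n w - sum_n (Aq_term q w) N)%C).
  { intros N HN. induction HN as [|N HN IH].
    - unfold Aq_trunc.
      replace (sum_n d n) with
        (sum_n (fun j => plus (RtoC (qpoch q q n / qpoch q q (n - j)) * Aq_term q w j)%C
                        (@mult C_Ring (- RtoC 1)%C (Aq_term q w j))) n).
      + rewrite sum_n_plus, (sum_n_mult_l (K := C_Ring)).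
        change (@plus _) with Cplus; change (@mult _) with Cmult.
        change (Ring.AbelianMonoid C_Ring) with C_AbelianMonoid. C_ring.
      + apply sum_n_ext_loc. intros j Hj. unfold d, c.
        destruct (le_lt_dec j n); [|lia]. change (@plus _) with Cplus; change (@mult _) with Cmult. C_ring.
    - rewrite !sum_Sn, IH. unfold d, c at 1.
      destruct (le_lt_dec (S N) n); [lia|]. unfold plus; simpl. C_ring. }
  assert (Hb : forall N, Cmod (sum_n d N) <= (eps + (1 / 2) ^ m) * M).
  { intros N. eapply Rle_trans; [apply Cmod_sum_n_le|].
    apply Rle_trans with
      (sum_n (fun j => plus (mult eps (Aq_abs_term q (Cmod w) j))
         (mult (if le_lt_dec j m then 0 else (1 / 2) ^ j) M)) N).
    - apply sum_n_m_le. intros j. unfold d, plus, mult; simpl.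
      rewrite Cmod_mult, Cmod_Aq_term by exact Hq.
      assert (HT := Aq_abs_term_ge_0 q (Cmod w) j Hq Hw).
      rewrite <- RtoC_minus, Cmod_R.
      assert (Hc1 : Rabs (c j - 1) <= 1).
      { unfold c. destruct (le_lt_dec j n) as [Hj|Hj].
        - destruct (qpoch_quot_bounds q n j Hq Hj) as [_ H2].
          assert (0 < qpoch q q n / qpoch q q (n - j))
            by (apply Rdiv_lt_0_compat; now apply qpoch_pos).
          rewrite Rabs_left1; lra.
        - rewrite Rabs_left1; lra. }
      destruct (le_lt_dec j m) as [Hj|Hj].
      + rewrite Rmult_0_l, Rplus_0_r. apply Rmult_le_compat_r; [exact HT|].
        unfold c. destruct (le_lt_dec j n) as [Hjn|Hjn]; [|lia].
        destruct (qpoch_quot_bounds q n j Hq Hjn) as [H1 H2].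
        rewrite Rabs_left1 by lra.
        apply Rle_trans with (q ^ (n - j) / (1 - q)); [lra|].
        apply Rmult_le_compat_r; [left; apply Rinv_0_lt_compat; lra|].
        apply pow_le_antimono; [exact Hq|lia].
      + specialize (Htail j Hj).
        assert (0 <= eps * Aq_abs_term q (Cmod w) j) by now apply Rmult_le_pos.
        apply Rle_trans with (1 * Aq_abs_term q (Cmod w) j); [|lra].
        now apply Rmult_le_compat_r.
    - rewrite sum_n_plus, (sum_n_mult_l (K := R_Ring)), (sum_n_mult_r (K := R_Ring)).
      unfold plus, mult; simpl. rewrite Rmult_plus_distr_r.
      apply Rplus_le_compat.
      + apply Rmult_le_compat_l; [exact Heps|]. now apply sum_Aq_abs_le.
      + apply Rmult_le_compat_r; [exact HM|]. apply sum_half_pow_tail. }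
  (* The bound [Hb] is uniform in [N], so it survives the limit of the partial sums. [Hd] identifies
     them only from [N = n] on, hence the eventual comparison below. *)
  assert (Hlim : is_lim_seq (fun N => Cmod (Aq_trunc q n w - sum_n (Aq_term q w) N)%C)
                   (Cmod (Aq_trunc q n w - Aq q w)%C)).
  { assert (H := Aq_is_series q w Hq).
    apply (is_lim_seq_ext
      (fun N => @norm R_AbsRing C_R_NormedModule
         (minus (Aq_trunc q n w) (sum_n (Aq_term q w) N)))).
    { intros N. rewrite <- Cmod_norm. reflexivity. }
    rewrite Cmod_norm.
    apply (filterlim_comp _ _ _ _
      (@norm R_AbsRing C_R_NormedModule) _
      (@locally C_R_NormedModule (minus (Aq_trunc q n w) (Aq q w)))).
    2: apply (@filterlim_norm R_AbsRing C_R_NormedModule).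
    unfold minus.
    eapply filterlim_comp_2; [apply filterlim_const| |].
    - eapply filterlim_comp; [exact H|].
      apply (@filterlim_opp R_AbsRing C_R_NormedModule).
    - apply (@filterlim_plus R_AbsRing C_R_NormedModule). }
  refine (is_lim_seq_le_loc _ (fun _ => (eps + (1 / 2) ^ m) * M) _
    (Finite ((eps + (1 / 2) ^ m) * M)) _ Hlim (is_lim_seq_const _)).
  exists n. intros N HN. rewrite <- Hd by exact HN. apply Hb.
Qed.

(** * Decay of the majorant terms *)

(** The ratio of term [p + 1] to term [p] is [x q^(2p+1) / (1 - q^(p+1))]. For [p >= k] the
    numerator is largest at [p = k], and the denominator is at least [1 - q]. *)
Lemma Aq_abs_term_geom (q x : R) (k i : nat) : 0 < q < 1 -> 0 <= x ->
  Aq_abs_term q x (k + i)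
  <= (x * q ^ S (2 * k) / (1 - q)) ^ i * Aq_abs_term q x k.
Proof.
  intros Hq Hx. induction i as [|i IH].
  - rewrite Nat.add_0_r. simpl. lra.
  - rewrite Nat.add_succ_r. set (p := (k + i)%nat) in *.
    set (rho := x * q ^ S (2 * k) / (1 - q)) in *.
    assert (Hp := qpoch_pos q p Hq).
    assert (Hqp : 0 < q ^ p <= 1).
    { split; [apply pow_lt; lra|]. rewrite <- (pow1 p); apply pow_incr; lra. }
    assert (Hden : 1 - q <= 1 - q * q ^ p) by nra.
    assert (HT := Aq_abs_term_ge_0 q x p Hq Hx).
    assert (Hstep : Aq_abs_term q x (S p)
                    = x * q ^ S (2 * p) / (1 - q * q ^ p) * Aq_abs_term q x p).
    { unfold Aq_abs_term.
      replace (S p * S p)%nat with (p * p + S (2 * p))%nat by lia.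
      rewrite pow_add. simpl qpoch. rewrite <- (tech_pow_Rmult x p). field. lra. }
    rewrite Hstep.
    assert (Hr : x * q ^ S (2 * p) / (1 - q * q ^ p) <= rho).
    { assert (H1 : q ^ S (2 * p) <= q ^ S (2 * k))
        by (apply pow_le_antimono; [exact Hq|unfold p; lia]).
      assert (0 < q ^ S (2 * p)) by (apply pow_lt; lra).
      apply Rmult_le_compat.
      - apply Rmult_le_pos; lra.
      - left; apply Rinv_0_lt_compat; lra.
      - apply Rmult_le_compat_l; lra.
      - apply Rinv_le_contravar; lra. }
    assert (0 <= rho).
    { apply Rmult_le_pos; [|left; apply Rinv_0_lt_compat; lra].
      apply Rmult_le_pos; [exact Hx|]. apply pow_le; lra. }
    apply Rle_trans with (rho * Aq_abs_term q x p).
    + now apply Rmult_le_compat_r.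
    + simpl pow. rewrite Rmult_assoc. now apply Rmult_le_compat_l.
Qed.

Lemma nat_floor (x : R) : 0 <= x ->
  exists k : nat, Int_part x = Z.of_nat k /\ INR k <= x < INR k + 1.
Proof.
  intros Hx. destruct (base_Int_part x) as [H1 H2].
  assert (H : (-1 < Int_part x)%Z) by (apply lt_IZR; lra).
  exists (Z.to_nat (Int_part x)).
  assert (He : Int_part x = Z.of_nat (Z.to_nat (Int_part x))) by lia.
  split; [exact He|]. rewrite INR_IZR_INZ, <- He. lra.
Qed.

(** Start from [k = floor(n tau)]. Each of the [j - k] steps up to [j] gains a factor [2^(-K)], so
    term [j] is at most [2^(-K(j-k))] times term [k], and term [k] is at most the whole sum. *)
Lemma Aq_abs_term_tail (q B t sigma : R) :
  0 < q < 1 -> 0 < B -> 0 < sigma -> t / 2 < sigma ->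
  exists n0 : nat, forall n : nat, (n0 <= n)%nat ->
  forall x : R, 0 <= x <= B * Rpower q (- (INR n * t)) ->
  forall j : nat, INR n * sigma < INR j ->
  Aq_abs_term q x j <= (1 / 2) ^ j * Re (Aq q (RtoC (- x))).
Proof.
  intros Hq HB Hs Hts.
  set (tau := (sigma + Rmax 0 (t / 2)) / 2).
  assert (Htau : 0 < tau /\ t / 2 < tau < sigma).
  { unfold tau. apply Rmax_case_strong; lra. }
  (* [K * (j - n tau) >= j] as soon as [j >= n sigma], so that [2^(-K)] is a
     small enough ratio. *)
  destruct (nfloor_ex (sigma / (sigma - tau))) as [K0 [_ HK0]].
  { left. apply Rdiv_lt_0_compat; lra. }
  set (K := S K0).
  assert (HK : sigma <= INR K * (sigma - tau)).
  { unfold K. rewrite S_INR.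
    apply (Rmult_lt_compat_r (sigma - tau)) in HK0; [|lra].
    unfold Rdiv in HK0. rewrite Rmult_assoc, Rinv_l in HK0 by lra. lra. }
  (* At index [n tau] the ratio bound is of order [B g^n], and [2 tau > t] makes [g < 1]. *)
  set (g := Rpower q (2 * tau - t)).
  assert (Hg : 0 < g < 1).
  { split; [apply Rpower_gt_0|]. apply Rpower_lt_1; lra. }
  destruct (pow_lt_1_zero g) with (y := (1 / 2) ^ K * (q * (1 - q) / B)) as [n0 Hn0].
  { rewrite Rabs_pos_eq; lra. }
  { apply Rmult_lt_0_compat; [apply pow_lt; lra|].
    apply Rdiv_lt_0_compat; [|lra]. nra. }
  exists n0. intros n Hn x [Hx0 Hx] j Hj.
  specialize (Hn0 n Hn).
  assert (Hgn : 0 < g ^ n) by (apply pow_lt; lra).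
  rewrite Rabs_pos_eq in Hn0 by lra.
  assert (Hn_pos := pos_INR n).
  destruct (nat_floor (INR n * tau)) as [k [_ [Hk1 Hk2]]].
  { apply Rmult_le_pos; lra. }
  assert (HKj : (j <= K * (j - k))%nat /\ (k <= j)%nat).
  { assert (Hkj : (k <= j)%nat) by (apply INR_le; nra).
    split; [|exact Hkj].
    apply INR_le. rewrite mult_INR, minus_INR by exact Hkj.
    assert (HK1 : 1 <= INR K) by (unfold K; rewrite S_INR; generalize (pos_INR K0); lra).
    (* With [K >= 1] and [j > n sigma]: [K(j - n tau) - j >= (K-1) n sigma - K n tau = n (K(sigma -
       tau) - sigma) >= 0]. *)
    assert (INR n * sigma <= INR n * (INR K * (sigma - tau)))
      by (apply Rmult_le_compat_l; lra).
    assert (INR K * INR k <= INR K * (INR n * tau)) by (apply Rmult_le_compat_l; lra).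
    assert ((INR K - 1) * (INR n * sigma) <= (INR K - 1) * INR j)
      by (apply Rmult_le_compat_l; lra).
    lra. }
  destruct HKj as [HKj Hkj].
  assert (Hrho : 0 <= x * q ^ S (2 * k) / (1 - q) <= (1 / 2) ^ K).
  { assert (Hqk : 0 < q ^ S (2 * k)) by (apply pow_lt; lra).
    split.
    - apply Rmult_le_pos; [|left; apply Rinv_0_lt_compat; lra].
      apply Rmult_le_pos; lra.
    (* Since [k > n tau - 1], the exponent [2k + 1] exceeds [2 n tau - 1]. The floor thus costs the
       factor [1/q] that the threshold for [g ^ n] anticipates. *)
    - assert (H1 : q ^ S (2 * k) <= Rpower q (2 * (INR n * tau) - 1)).
      { rewrite <- Rpower_pow by lra. apply Rpower_le_antimono; [exact Hq|].
        rewrite S_INR, mult_INR. simpl. lra. }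
      assert (H2 : x * q ^ S (2 * k) <= B * (g ^ n / q)).
      { replace (g ^ n / q) with
          (Rpower q (- (INR n * t)) * Rpower q (2 * (INR n * tau) - 1)).
        - rewrite <- Rmult_assoc. apply Rmult_le_compat; lra.
        - unfold g. rewrite <- Rpower_pow, Rpower_mult by apply Rpower_gt_0.
          rewrite <- Rpower_plus. unfold Rdiv.
          rewrite <- (Rpower_1 q) at 3 by lra.
          rewrite <- Rpower_Ropp, <- Rpower_plus. f_equal. ring. }
      apply Rmult_le_reg_r with (1 - q); [lra|].
      replace (x * q ^ S (2 * k) / (1 - q) * (1 - q)) with (x * q ^ S (2 * k))
        by (field; lra).
      eapply Rle_trans; [exact H2|].
      apply Rmult_le_reg_r with (q / B); [apply Rdiv_lt_0_compat; lra|].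
      replace (B * (g ^ n / q) * (q / B)) with (g ^ n) by (field; lra).
      replace ((1 / 2) ^ K * (1 - q) * (q / B))
        with ((1 / 2) ^ K * (q * (1 - q) / B)) by (field; lra).
      lra. }
  replace j with (k + (j - k))%nat at 1 by lia.
  eapply Rle_trans; [now apply Aq_abs_term_geom|].
  apply Rmult_le_compat.
  - apply pow_le; lra.
  - now apply Aq_abs_term_ge_0.
  - apply Rle_trans with (((1 / 2) ^ K) ^ (j - k)); [now apply pow_incr|].
    rewrite <- pow_mult. apply pow_le_antimono; [lra|exact HKj].
  - now apply Aq_abs_term_le.
Qed.

(** * Both expansions *)

(** Take [m = floor(n sigma)] in the remainder bound. Then [n - m >= n(1 - sigma)], every [j > m]
    satisfies [j > n sigma], and the coefficient 1 of [2^(-m)] is at most [2/(1-q)]. *)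
Lemma Aq_trunc_asymptotics (q B t sigma : R) :
  0 < q < 1 -> 0 < B -> 0 < sigma < 1 -> t / 2 < sigma ->
  exists n0 : nat, forall n : nat, (n0 <= n)%nat ->
  forall w : C, Cmod w <= B * Rpower q (- (INR n * t)) ->
  Cmod (Aq_trunc q n w - Aq q w)
  <= (Rpower q (INR n * (1 - sigma)) / (1 - q)
      + 2 / (1 - q) * powerRZ (1 / 2) (Int_part (INR n * sigma)))
     * Re (Aq q (RtoC (- Cmod w))).
Proof.
  intros Hq HB Hs Hts.
  destruct (Aq_abs_term_tail q B t sigma Hq HB) as [n0 Hn0]; [lra|exact Hts|].
  exists n0. intros n Hn w Hw.
  assert (Hn_pos := pos_INR n). assert (Hw0 := Cmod_ge_0 w).
  destruct (nat_floor (INR n * sigma)) as [m [Hm [Hm1 Hm2]]].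
  { apply Rmult_le_pos; lra. }
  assert (Hmn : (m <= n)%nat) by (apply INR_le; nra).
  rewrite Hm, <- pow_powerRZ.
  eapply Rle_trans; [apply (Aq_trunc_remainder q n m w Hq Hmn)|].
  - intros j Hj. apply (Hn0 n Hn); [lra|].
    apply le_INR in Hj. rewrite S_INR in Hj. lra.
  - apply Rmult_le_compat_r.
    { eapply Rle_trans; [|apply (Aq_abs_term_le q (Cmod w) 0 Hq Hw0)].
      now apply Aq_abs_term_ge_0. }
    apply Rplus_le_compat.
    + apply Rmult_le_compat_r; [left; apply Rinv_0_lt_compat; lra|].
      rewrite <- Rpower_pow by lra. apply Rpower_le_antimono; [exact Hq|].
      rewrite minus_INR by exact Hmn. lra.
    + assert (0 < (1 / 2) ^ m) by (apply pow_lt; lra).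
      assert (1 <= 2 / (1 - q)).
      { apply Rmult_le_reg_r with (1 - q); [lra|].
        unfold Rdiv. rewrite Rmult_assoc, Rinv_l; lra. }
      nra.
Qed.

Theorem theorem1 :
  forall q B : R, 0 < q < 1 -> 0 < B ->
  (forall t : R, t < 2 ->
     let sigma := Rmax (1 / 2) (1 / 2 + t / 4) in
     exists n0 : nat, forall n : nat, (n0 <= n)%nat ->
     forall u : C, Cmod u <= B ->
       let z : C := (u * RtoC (Rpower q (- (INR n * t))))%C in
       exists r : C,
         SW q n z = (RtoC (1 / qpoch q q n) * (Aq q z + r))%C /\
         Cmod r <=
           (Rpower q (INR n * (1 - sigma)) / (1 - q)
            + 2 / (1 - q) * powerRZ (1 / 2) (Int_part (INR n * sigma)))
           * Re (Aq q (RtoC (- Cmod z))))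
  /\
  (forall t : R, 0 < t ->
     let delta := Rmin (3 / 2) (1 + t / 4) in
     exists n0 : nat, forall n : nat, (n0 <= n)%nat ->
     forall u : C, 1 / B <= Cmod u ->
       let z : C := (u * RtoC (Rpower q (- (INR n * t))))%C in
       exists r : C,
         SW q n z =
           ((- z) ^ n * RtoC (q ^ (n * n)%nat / qpoch q q n)
            * (Aq q (RtoC (/ q ^ (2 * n)%nat) / z) + r))%C /\
         Cmod r <=
           (Rpower q (INR n * (delta - 1)) / (1 - q)
            + 2 / (1 - q) * powerRZ (1 / 2) (Int_part (INR n * (2 - delta))))
           * Re (Aq q (RtoC (- (/ q ^ (2 * n)%nat / Cmod z))))).
Proof.
  intros q B Hq HB. split.
  - intros t Ht sigma.
    (* Both [1/2 + t/4 < 1] and [t/2 < 1/2 + t/4] amount to [t < 2]. *)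
    assert (Hs : 0 < sigma < 1 /\ t / 2 < sigma).
    { unfold sigma. apply Rmax_case_strong; lra. }
    destruct (Aq_trunc_asymptotics q B t sigma Hq HB) as [n0 Hn0]; [lra|lra|].
    exists n0. intros n Hn u Hu z.
    exists (Aq_trunc q n z - Aq q z)%C. split.
    + rewrite SW_trunc by exact Hq. ring.
    + apply Hn0; [exact Hn|]. unfold z.
      assert (HR := Rpower_gt_0 q (- (INR n * t))).
      rewrite Cmod_mult, Cmod_R, Rabs_pos_eq by lra.
      apply Rmult_le_compat_r; lra.
  - intros t Ht delta.
    (* [2 - delta = max(1/2, 1/2 + (2-t)/4)] is the [sigma] of the first part for [2 - t]. *)
    assert (Hd : 0 < 2 - delta < 1 /\ (2 - t) / 2 < 2 - delta).
    { unfold delta. apply Rmin_case_strong; lra. }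
    destruct (Aq_trunc_asymptotics q B (2 - t) (2 - delta) Hq HB) as [n0 Hn0];
      [lra|lra|].
    exists n0. intros n Hn u Hu z.
    assert (HR := Rpower_gt_0 q (- (INR n * t))).
    assert (HB1 : 0 < 1 / B) by (apply Rdiv_lt_0_compat; lra).
    assert (HCz : Cmod z = Cmod u * Rpower q (- (INR n * t))).
    { unfold z. rewrite Cmod_mult, Cmod_R, Rabs_pos_eq by lra. reflexivity. }
    assert (HCz0 : 0 < Cmod z) by (rewrite HCz; apply Rmult_lt_0_compat; lra).
    assert (Hz : z <> RtoC 0) by (now apply Cmod_gt_0).
    assert (Hq2 : 0 < / q ^ (2 * n)) by (apply Rinv_0_lt_compat, pow_lt; lra).
    set (w := (RtoC (/ q ^ (2 * n)) / z)%C).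
    assert (HCw : Cmod w = / q ^ (2 * n) / Cmod z).
    { unfold w. rewrite Cmod_div, Cmod_R, Rabs_pos_eq by (lra || exact Hz).
      reflexivity. }
    exists (Aq_trunc q n w - Aq q w)%C. split.
    + rewrite SW_trunc_rev by assumption. fold w. ring.
    + rewrite <- HCw. replace (delta - 1) with (1 - (2 - delta)) by ring.
      apply Hn0; [exact Hn|]. rewrite HCw, HCz.
      (* Here [|w| = q^(-2n) q^(nt) / |u| = q^(-n(2-t)) / |u|], and [1/|u| <= B]. *)
      assert (HE : Rpower q (- (INR n * (2 - t)))
                   = / q ^ (2 * n) / Rpower q (- (INR n * t))).
      { unfold Rdiv. rewrite <- Rpower_pow, <- !Rpower_Ropp, <- Rpower_plus by lra.
        f_equal. rewrite mult_INR. simpl. ring. }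
      rewrite HE.
      assert (HuB : / Cmod u <= B).
      { replace B with (/ (1 / B)) by (field; lra). apply Rinv_le_contravar; lra. }
      unfold Rdiv. rewrite Rinv_mult.
      replace (/ q ^ (2 * n) * (/ Cmod u * / Rpower q (- (INR n * t))))
        with (/ Cmod u * (/ q ^ (2 * n) * / Rpower q (- (INR n * t)))) by ring.
      apply Rmult_le_compat_r; [|exact HuB].
      apply Rmult_le_pos; [lra|]. left. now apply Rinv_0_lt_compat.
Qed.
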